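(* Let $\mathcal{X}$ be a measurable space, $\mu$ a probability measure on $\mathcal{X}$, and $\varphi:\mathcal{X}\to\mathbb{R}$ a measurable function. (i) For all $0<\rho\le\rho'<1$, $F_{\rho'}(\varphi;\mu)\le F_\rho(\varphi;\mu)$. (ii) As $\rho\to0+$, $F_\rho(\varphi;\mu)\to F(\varphi;\mu)$. (iii) If $F(2\varphi;\mu)<\infty$, denote $\varkappa(\varphi;\mu):=e^{F(2\varphi;\mu)-2F(\varphi;\mu)}$. Then for any $\rho\in\left(0,\frac{1}{\varkappa(\varphi;\mu)}\right)$, $$F_\rho(\varphi;\mu)\ge F(\varphi;\mu)+\frac{\rho}{2}+\log\left(1-\rho\,\varkappa(\varphi;\mu)\right).$$ (iv) If $M\in\mathbb{R}$ and $\varphi(x)\le M$ for all $x\in\mathcal{X}$, then for any $\rho\in\left(0,e^{F(\varphi;\mu)-M}\right)$, $$F_\rho(\varphi;\mu)\ge F(\varphi;\mu)-\rho\,e^{M-F(\varphi;\mu)}.$$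
   Context: $F(\varphi;\mu):=\log\int_{\mathcal{X}}e^{\varphi(x)}\,d\mu(x)\in(-\infty,\infty]$. For $0<\rho<1$, define $f_\rho$ on $[0,\infty)$ by $f_\rho(t)=t\log t+1+\frac{1-\rho t}{\rho}\log(1-\rho t)$ for $0\le t\le\frac1\rho$ (with $0\log0=0$) and $f_\rho(t)=+\infty$ otherwise. The Safe KL divergence is $D_\rho(\nu,\mu):=\int_{\mathcal{X}}f_\rho\left(\frac{d\nu}{d\mu}(x)\right)d\mu(x)$ if $\nu\ll\mu$ and $+\infty$ otherwise. With $\mathcal{P}(\mathcal{X})$ the set of probability measures on $\mathcal{X}$, $$F_\rho(\varphi;\mu):=\sup_\nu\left\{\int_{\mathcal{X}}\varphi\,d\nu-D_\rho(\nu,\mu):\ \nu\in\mathcal{P}(\mathcal{X}),\ \int_{\mathcal{X}}|\varphi|\,d\nu<\infty\right\}.$$ Equivalently, $$F_\rho(\varphi;\mu)=\inf_{\alpha\in\mathbb{R}}\left\{\alpha-1+\frac1\rho\int_{\mathcal{X}}\log\left(1+\rho e^{\varphi(x)-\alpha}\right)d\mu(x)\right\}.$$ *)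

(* Defs.v *)
From HB Require Import structures.
From mathcomp Require Import all_boot all_order all_algebra.
From mathcomp Require Import all_classical all_reals all_analysis.

Set Implicit Arguments.
Unset Strict Implicit.
Unset Printing Implicit Defensive.

Import Order.TTheory GRing.Theory Num.Theory.
Import numFieldNormedType.Exports.

Local Open Scope classical_set_scope.
Local Open Scope ring_scope.
Local Open Scope charge_scope.
Local Open Scope ereal_scope.

(* F(phi; mu); [lne] is the extended logarithm, with [lne +oo = +oo]. *)
Definition log_int_exp (d : measure_display) (X : measurableType d)
    (R : realType) (phi : X -> R) (mu : probability X R) : \bar R :=
  lne (\int[mu]_x (expR (phi x))%:E).

(* f_rho. Since [ln 0 = 0], the convention 0 log 0 = 0 holds at both endpoints
   [t = 0] and [t = rho^-1]. *)
Definition safe_kl_fun (R : realType) (rho t : R) : \bar R :=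
  if (0 <= t <= rho^-1)%R then
    (t * ln t + 1 + (1 - rho * t) / rho * ln (1 - rho * t))%:E
  else +oo.

(* D_rho(nu, mu). When [nu `<< mu] the Radon-Nikodym derivative is everywhere
   finite, so [fine] loses nothing; it is nonnegative mu-almost everywhere. *)
Definition safe_kl (d : measure_display) (X : measurableType d)
    (R : realType) (rho : R) (nu mu : probability X R) : \bar R :=
  if `[< nu `<< mu >] then
    \int[mu]_x
      safe_kl_fun rho (fine (('d (charge_of_finite_measure nu) '/d mu) x))
  else +oo.

(* F_rho(phi; mu) *)
Definition safe_log_int_exp (d : measure_display) (X : measurableType d)
    (R : realType) (rho : R) (phi : X -> R) (mu : probability X R) : \bar R :=
  ereal_sup [set \int[nu]_x (phi x)%:E - safe_kl rho nu mu
            | nu in [set nu : probability X R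
                    | \int[nu]_x `|(phi x)%:E| < +oo]].

(* varkappa(phi; mu) = exp (F(2 phi; mu) - 2 F(phi; mu)), meant for
   F(2 phi; mu) < +oo, in which case both terms are finite. *)
Definition exp_kappa (d : measure_display) (X : measurableType d)
    (R : realType) (phi : X -> R) (mu : probability X R) : \bar R :=
  expeR (log_int_exp (fun x => 2 * phi x)%R mu - 2%:E * log_int_exp phi mu).

(* Main.v *)
Require Import Defs.
From HB Require Import structures.
From mathcomp Require Import all_boot all_order all_algebra.
From mathcomp Require Import all_classical all_reals all_analysis.
From mathcomp Require Import measurable_realfun ring lra.

Set Implicit Arguments.
Unset Strict Implicit.
Unset Printing Implicit Defensive.

Import Order.TTheory GRing.Theory Num.Theory.
Import numFieldNormedType.Exports.

Local Open Scope classical_set_scope.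
Local Open Scope ring_scope.

(* A density [p] with respect to [mu] such that
   [f_rho (p x) <= phi x * p x - a * p x - b] pointwise certifies the lower
   bound [a + b <= F_rho], so every lower bound comes down to a choice of [p].
   The Gibbs density [e^phi / z], restricted to a set where [phi] is bounded,
   gives (iv) and the lower half of (ii), through
   [f_rho t <= t ln t + 1 - t + rho t^2].  For (iii), with
   [q = e^phi / z], one takes the optimal shape [y q / (1 + rho y q)]; the
   intermediate value theorem yields a normalizing [y] between [1] and
   [1 / (1 - rho kappa)].  The upper half of (ii) is Young's inequality
   [t ln c + 1 - c <= f_rho t] with [c = e^phi / z], and (i) holds because
   [f_rho] increases with [rho], by convexity of [x ln x]. *)

(** * Elementary inequalities for [x * ln x] and [ln (1 - v)] *)

Section real_inequalities.
Context {R : realType}.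
Implicit Types (rho t c x : R).

(** The tangent line at [c] of the convex function [x * ln x]; it comes from [ln (1 + u) <= u] at
    [u = c / x - 1]. At [x = 0] the value [ln 0] is multiplied by zero. *)
Lemma xlnx_ge c x : 0 < c -> 0 <= x -> x * ln c + x - c <= x * ln x.
Proof.
move=> c0; rewrite le_eqVlt => /predU1P[<-|x0]; first by rewrite !mul0r; lra.
have : ln (1 + (c / x - 1)) <= c / x - 1.
  by apply: le_ln1Dx; have := divr_gt0 c0 x0; lra.
have -> : 1 + (c / x - 1) = c / x by ring.
rewrite ln_div// => h.
have := ler_wpM2l (ltW x0) h.
have -> : x * (c / x - 1) = c - x by field; rewrite gt_eqF.
by rewrite mulrBr; lra.
Qed.

(** Convexity between [x] and [1], where [x * ln x] vanishes: the tangent inequalities at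
    [y = l * x + (1 - l)] are averaged with weights [l] and [1 - l]. *)
Lemma xlnx_convex (l x : R) : 0 <= l <= 1 -> 0 <= x ->
  (l * x + (1 - l)) * ln (l * x + (1 - l)) <= l * (x * ln x).
Proof.
move=> /andP[l0 l1] x0; set y := l * x + (1 - l).
have l1' : 0 <= 1 - l by lra.
have lx0 : 0 <= l * x by exact: mulr_ge0.
(* A tangent exists only at [y > 0]; otherwise [l = 1] and [x = 0], and both sides vanish. *)
have [y0|y0] := leP y 0.
  have l1e : l = 1 by rewrite /y in y0; lra.
  have x0e : x = 0 by move: y0; rewrite /y l1e; lra.
  by rewrite /y l1e x0e subrr addr0 !mul1r !mul0r.
have h1 := ler_wpM2l l0 (xlnx_ge y0 x0).
have := ler_wpM2l l1' (xlnx_ge y0 (@ler01 R)).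
rewrite ln1; move: h1; set L := ln y; rewrite /y; set K := x * ln x.
lra.
Qed.

(** The difference of the two sides vanishes at [0] and has derivative [- x ^+ 2 / (1 - x) <= 0].
    The quadratic term is kept because it produces the [rho / 2] in (iii). *)
Lemma ln1B_le_quadratic (v : R) : 0 <= v < 1 -> ln (1 - v) <= - v - v ^+ 2 / 2.
Proof.
move=> /andP[v0 v1].
pose f x : R := ln (1 - x) + (x + x ^+ 2 / 2).
have df x : x < 1 -> is_derive x 1 f (- (1 - x)^-1 + (1 + x)).
  move=> x1; have x1' : 0 < 1 - x by lra.
  apply: is_deriveD; last first.
    apply: is_derive_eq; rewrite /GRing.scale/=. by field.
  have := @is_derive1_comp _ (@ln R) (fun x : R => 1 - x) x (1-x)^-1 (-1).
  rewrite mulrN1; apply; first exact: is_derive1_ln.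
  apply: is_derive_eq; rewrite /GRing.scale/=. by ring.
have : f v <= f 0.
  apply: (@ler0_derive1_le_cc _ f 0 v).
  - by move=> x; rewrite in_itv/= => /andP[_ xv]; have [] := df x (lt_trans xv v1).
  - move=> x; rewrite in_itv/= => /andP[x0 xv].
    have x1 := lt_trans xv v1; rewrite derive1E (@derive_val _ _ _ _ _ _ _ (df x x1)).
    have x1' : 0 < 1 - x by lra.
    have -> : - (1 - x)^-1 + (1 + x) = - (x ^+ 2 / (1 - x)) by field; lra.
    by rewrite oppr_le0 divr_ge0 ?sqr_ge0// ltW.
  - apply: derivable_within_continuous => x; rewrite in_itv/= => /andP[_ xv].
    by have [] := df x (le_lt_trans xv v1).
  - by rewrite in_itv/= lexx v0.
  - by rewrite in_itv/= lexx v0.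
  - by [].
by rewrite /f subr0 ln1 expr0n/= mul0r !addr0; lra.
Qed.

End real_inequalities.

(** * Normalization of the optimal density shape *)

Section tilted_density.
Context d (X : measurableType d) (R : realType).
Variables (mu : probability X R) (q : X -> R) (rho : R).
Hypothesis mq : measurable_fun [set: X] q.
Hypothesis q0 : forall x, 0 < q x.
Hypothesis r0 : 0 < rho.
Hypothesis iq : mu.-integrable [set: X] (EFin \o q).
Hypothesis q1 : \int[mu]_x q x = 1.

(* The absolute value makes the integral a globally Lipschitz function of [y];
   only [y >= 1] matters. *)
Let P (y : R) (x : X) : R := `|y| * q x / (1 + rho * (`|y| * q x)).

Let den_gt0 (y : R) x : 0 < 1 + rho * (`|y| * q x).
Proof. by rewrite ltr_wpDr// !mulr_ge0// ltW. Qed.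

Let P_ge0 y x : 0 <= P y x.
Proof. by rewrite /P divr_ge0 ?mulr_ge0// ltW. Qed.

Let P_le (y : R) x : P y x <= `|y| * q x.
Proof.
rewrite /P ler_pdivrMr// ler_peMr ?lerDl ?mulr_ge0//; exact: ltW.
Qed.

Let mP y : measurable_fun [set: X] (P y).
Proof.
have myq : measurable_fun [set: X] (fun x => `|y| * q x) by exact: measurable_funM.
(* Writing the reciprocal of the positive denominator as an exponential reduces measurability to
   that of [expR] and [ln]. *)
have -> : P y = fun x => `|y| * q x * expR (- ln (1 + rho * (`|y| * q x))).
  by apply/funext => x; rewrite expRN lnK// posrE.
apply: measurable_funM => //; apply: (measurableT_comp (@measurable_expR R)).
apply: measurableT_comp => //; apply: (measurableT_comp (@measurable_ln R)).
by apply: measurable_funD => //; exact: measurable_funM.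
Qed.

Let iyq (y : R) : mu.-integrable [set: X] (EFin \o (fun x => y * q x)).
Proof.
rewrite (_ : _ \o _ = fun x => (y%:E * (q x)%:E)%E); first exact: integrableZl.
by apply/funext => x /=; rewrite EFinM.
Qed.

Let iP y : mu.-integrable [set: X] (EFin \o P y).
Proof.
apply: (@le_integrable _ _ _ mu _ measurableT _ (EFin \o (fun x => `|y| * q x))) => //.
- by apply/measurable_EFinP; exact: mP.
- by move=> x _; rewrite lee_fin ger0_norm// (le_trans (P_le y x))// ler_norm.
Qed.

(** The cross terms cancel in the difference of the quotients, leaving [(|y| - |y'|) * q x] over a
    product of denominators that is at least [1]. Since [q] has integral [1], [G] is then
    1-Lipschitz. *)
Let P_dist (y y' : R) x : `|P y x - P y' x| <= `|y - y'| * q x.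
Proof.
have -> : P y x - P y' x = ((`|y| - `|y'|) * q x) /
    ((1 + rho * (`|y| * q x)) * (1 + rho * (`|y'| * q x))).
  by rewrite /P; field; rewrite !gt_eqF.
have D1 : 1 <= (1 + rho * (`|y| * q x)) * (1 + rho * (`|y'| * q x)).
  by rewrite mulr_ege1// lerDl !mulr_ge0// ltW.
have D0 := lt_le_trans ltr01 D1.
rewrite normrM normfV (gtr0_norm D0) ler_pdivrMr// normrM (gtr0_norm (q0 x)).
have N : `| `|y| - `|y'| | <= `|y - y'| by exact: ler_dist_dist.
rewrite (le_trans (y := `|y - y'| * q x))// ?ler_pM2r//.
by rewrite ler_peMr// mulr_ge0// ltW.
Qed.

Let G y := \int[mu]_x P y x.

Let G_dist (y y' : R) : `|G y - G y'| <= `|y - y'|.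
Proof.
have iB : mu.-integrable [set: X] (EFin \o (fun x => P y x - P y' x)).
  rewrite (_ : _ \o _ = fun x => ((P y x)%:E - (P y' x)%:E)%E).
    by apply: integrableB => //; exact: iP.
  by apply/funext => x /=; rewrite EFinB.
rewrite /G -RintegralB//; [|exact: iP..].
apply: (le_trans (le_normr_Rintegral _ iB)) => //.
rewrite -[leRHS]mulr1 -q1 -RintegralZl//; apply: le_Rintegral => //.
exact: (integrable_norm iB).
Qed.

Let G_continuous : continuous G.
Proof.
move=> y; apply/cvgrPdist_le => e e0; near=> y'.
apply: (le_trans (G_dist _ _)).
near: y'; exact: cvgr_dist_le.
Unshelve. all: by end_near. Qed.

Lemma tilted_density_exists (k : R) :
  mu.-integrable [set: X] (EFin \o (fun x => q x ^+ 2)) ->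
  \int[mu]_x (q x ^+ 2) = k -> rho * k < 1 ->
  exists2 y : R, 1 <= y <= (1 - rho * k)^-1 &
    (\int[mu]_x (y * q x / (1 + rho * (y * q x)))%:E = 1)%E /\
    measurable_fun [set: X] (fun x => y * q x / (1 + rho * (y * q x))).
Proof.
move=> iq2 kE rk.
have k0 : 0 <= k by rewrite -kE; apply: Rintegral_ge0 => x _; exact: sqr_ge0.
set c := 1 - rho * k; have c0 : 0 < c by rewrite subr_gt0.
have c1 : c <= 1 by rewrite /c gerBl mulr_ge0// ltW.
have y1 : 1 <= c^-1 by rewrite invf_ge1.
have G1 : G 1 <= 1.
  rewrite -[leRHS]q1; apply: (le_Rintegral measurableT (iP 1) iq).
  by move=> x _; rewrite (le_trans (P_le _ _))// normr1 mul1r.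
have iq2' : mu.-integrable [set: X] (EFin \o (fun x => rho * q x ^+ 2)).
  rewrite (_ : _ \o _ = fun x => (rho%:E * (q x ^+ 2)%:E)%E); first exact: integrableZl.
  by apply/funext => x /=; rewrite EFinM.
have iB : mu.-integrable [set: X] (EFin \o (fun x => (2 - c) * q x - rho * q x ^+ 2)).
  rewrite (_ : _ \o _ = fun x => (((2 - c) * q x)%:E - (rho * q x ^+ 2)%:E)%E).
    by apply: integrableB => //; exact: iyq.
  by apply/funext => x /=; rewrite EFinB.
(* With [w = 1 + rho * q / c], the integrand [q / (c * w)] is at least [q * (2 - c * w) = (2 - c) *
   q - rho * q ^+ 2]. The integral of this minorant is [2 - c - rho * k], which is [1] by the choice
   of [c]. *)
have G2 : 1 <= G c^-1.
  have -> : 1 = \int[mu]_x ((2 - c) * q x - rho * q x ^+ 2).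
    rewrite (RintegralB measurableT (iyq _) iq2').
    by rewrite !RintegralZl// q1 kE /c; ring.
  apply: (le_Rintegral measurableT iB (iP c^-1)).
  move=> x _; rewrite /P (gtr0_norm (lt_le_trans ltr01 y1)).
  set w := 1 + _; have w0 : 0 < w.
    by rewrite /w addr_gt0// !mulr_gt0 ?invr_gt0.
  (* [1 / (c w) >= 2 - c w] *)
  rewrite ler_pdivlMr// -subr_ge0.
  have -> : c^-1 * q x - ((2 - c) * q x - rho * q x ^+ 2) * w =
            q x / c * (1 - c * w) ^+ 2.
    by rewrite /w; field; rewrite gt_eqF.
  by rewrite mulr_ge0 ?sqr_ge0// divr_ge0// ltW.
have [|y] := @IVT R G 1 c^-1 1 y1 (continuous_subspaceT G_continuous).
  by rewrite ge_min le_max G1 G2 orbT.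
rewrite in_itv/= => yc Gy; exists y => //.
have [y1' _] := andP yc; have y0 := lt_le_trans ltr01 y1'.
have PE : P y = fun x => y * q x / (1 + rho * (y * q x)).
  by apply/funext => x; rewrite /P (gtr0_norm y0).
rewrite -PE; split; last exact: mP.
have := integrable_fin_num measurableT (iP y).
by rewrite -[in RHS]Gy /G /Rintegral PE => /fineK ->.
Qed.

End tilted_density.

(** * Pointwise bounds on f_rho *)

Section safe_kl_fun_theory.
Context {R : realType}.
Implicit Types (rho t c x : R).
Local Open Scope ereal_scope.

(** Sum of two tangent bounds: [t * ln t] at [c], and [s * ln s] at [1] for [s = 1 - rho * t], the
    latter contributing [- t] after division by [rho]. *)
Lemma safe_kl_fun_ge rho t c : (0 < rho)%R -> (0 < c)%R ->
  (t * ln c + 1 - c)%:E <= safe_kl_fun rho t.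
Proof.
move=> r0 c0; rewrite /safe_kl_fun; case: ifPn => [/andP[t0 tr]|_]; last exact: leey.
rewrite lee_fin.
have rt : (0 <= 1 - rho * t)%R by rewrite subr_ge0 mulrC -ler_pdivlMr// div1r.
have h1 := xlnx_ge c0 t0.
have h2 : (- t <= (1 - rho * t) / rho * ln (1 - rho * t))%R.
  have := xlnx_ge ltr01 rt; rewrite ln1 mulr0 add0r => h.
  rewrite mulrAC ler_pdivlMr//; lra.
lra.
Qed.

Lemma safe_kl_fun_ge0 rho t : (0 < rho)%R -> 0 <= safe_kl_fun rho t.
Proof.
by move=> r0; have := safe_kl_fun_ge t r0 ltr01; rewrite ln1 mulr0 add0r subrr.
Qed.

(** Follows from [ln (1 - v) <= - v] at [v = rho * t], multiplied by [(1 - v) / rho]. *)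
Lemma safe_kl_fun_le rho t : (0 < rho)%R -> (0 <= t)%R -> (rho * t <= 1)%R ->
  safe_kl_fun rho t <= (t * ln t + 1 - t + rho * t ^+ 2)%:E.
Proof.
move=> r0 t0 tr; have tr' : (t <= rho^-1)%R by rewrite -div1r ler_pdivlMr// mulrC.
rewrite /safe_kl_fun t0 tr'/=.
rewrite lee_fin.
have rt : (0 <= 1 - rho * t)%R by rewrite subr_ge0.
suff : ((1 - rho * t) / rho * ln (1 - rho * t) <= - t + rho * t ^+ 2)%R by lra.
rewrite mulrAC ler_pdivrMr//.
(* The logarithmic inequality requires [v < 1]; at [v = 1] both sides are zero. *)
have [e|n] := eqVneq (rho * t)%R 1%R.
  rewrite e subrr mul0r.
  have -> : ((- t + rho * t ^+ 2) * rho = (rho * t) * (rho * t - 1))%R by ring.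
  by rewrite e subrr mulr0.
have h : (ln (1 - rho * t) <= - (rho * t))%R.
  by apply: le_ln1Dx; rewrite ltrN2 lt_def eq_sym n.
by have := ler_wpM2l rt h; lra.
Qed.

(** Only the last term of f_rho depends on [rho]. With [l = rho / rho'], the point [1 - rho * t] is
    the average of [1 - rho' * t] and [1] with weights [l] and [1 - l], so [xlnx_convex] applies. *)
Lemma le_safe_kl_fun rho rho' t : (0 < rho)%R -> (rho <= rho')%R ->
  safe_kl_fun rho t <= safe_kl_fun rho' t.
Proof.
move=> r0 rr'; have r'0 := lt_le_trans r0 rr'.
rewrite /safe_kl_fun; have [/andP[t0 tr]|_] := boolP (0 <= t <= rho'^-1)%R; last exact: leey.
have tr' : (t <= rho^-1)%R by rewrite (le_trans tr)// lef_pV2.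
rewrite t0 tr' lee_fin lerD2l.
have rt : (0 <= 1 - rho' * t)%R by rewrite subr_ge0 mulrC -ler_pdivlMr// div1r.
have l01 : (0 <= rho / rho' <= 1)%R.
  by rewrite divr_ge0 ?(ltW r0) ?(ltW r'0)//= ler_pdivrMr// mul1r.
have := xlnx_convex l01 rt.
have -> : (rho / rho' * (1 - rho' * t) + (1 - rho / rho') = 1 - rho * t)%R.
  by field; rewrite gt_eqF.
move=> h; rewrite [X in (X <= _)%R]mulrAC ler_pdivrMr// (le_trans h)//.
by rewrite le_eqVlt; apply/orP; left; apply/eqP; field; rewrite gt_eqF.
Qed.

Lemma measurable_safe_kl_fun rho : measurable_fun [set: R] (safe_kl_fun rho).
Proof.
apply: measurable_fun_ifT => //.
  apply: measurable_and; exact: measurable_fun_ler.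
apply/measurable_EFinP; apply: measurable_funD.
  apply: measurable_funD => //; apply: measurable_funM => //; exact: measurable_ln.
have mB : measurable_fun [set: R] (fun t : R => 1 - rho * t)%R.
  by apply: measurable_funB => //; exact: measurable_funM.
apply: measurable_funM; first exact: measurable_funM.
exact: (measurableT_comp (@measurable_ln R)).
Qed.

(* The optimal density in the variational formula: [u / (1 + rho u)] solves
   [f_rho' (t) = ln u]. *)
Lemma safe_kl_fun_opt rho u : (0 < rho)%R -> (0 < u)%R ->
  let p := (u / (1 + rho * u))%R in
  safe_kl_fun rho p <= (p * ln u + 1 - p - (rho * p ^+ 2) / 2)%:E.
Proof.
move=> r0 u0; set p := (u / _)%R; rewrite /=.
have w0 : (0 < 1 + rho * u)%R by rewrite addr_gt0// mulr_gt0.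
have p0 : (0 < p)%R by rewrite divr_gt0.
have e : (1 - rho * p = (1 + rho * u)^-1)%R by rewrite /p; field; lra.
have rt : (0 < 1 - rho * p)%R by rewrite e invr_gt0.
have rp : (rho * p < 1)%R by rewrite -subr_gt0.
have pr : (p <= rho^-1)%R by rewrite -div1r ler_pdivlMr// mulrC ltW.
rewrite /safe_kl_fun (ltW p0) pr/=.
rewrite lee_fin.
(* This identity merges both logarithms of f_rho into [p * ln u + 1 + L / rho], so that only an
   upper bound on [L = ln (1 - rho * p)] remains. *)
have lnp : (ln p = ln u + ln (1 - rho * p))%R.
  by rewrite e -lnM ?posrE ?invr_gt0.
have : (0 <= rho * p < 1)%R by rewrite rp mulr_ge0// ltW.
move=> /ln1B_le_quadratic; rewrite lnp; set L := ln (1 - _) => h.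
have -> : (p * (ln u + L) + 1 + (1 - rho * p) / rho * L = p * ln u + 1 + L / rho)%R.
  by field; rewrite gt_eqF.
suff : (L / rho <= - p - rho * p ^+ 2 / 2)%R by lra.
by rewrite ler_pdivrMr//; lra.
Qed.

End safe_kl_fun_theory.

Local Open Scope ereal_scope.

(** * Probability measures built from densities *)

Section density.
Context d (X : measurableType d) (R : realType).
Variables (mu : probability X R) (p : X -> R).
Hypothesis mp : measurable_fun [set: X] p.
Hypothesis p0 : forall x, (0 <= p x)%R.
Hypothesis p1 : \int[mu]_x (p x)%:E = 1.

Let nu (A : set X) := \int[mu]_(x in A) (p x)%:E.

Let nu0 : nu set0 = 0. Proof. exact: integral_set0. Qed.

Let nu_ge0 A : 0 <= nu A.
Proof. by apply: integral_ge0 => x _; rewrite lee_fin. Qed.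

Let nu_sigma_additive : semi_sigma_additive nu.
Proof.
apply: semi_sigma_additive_nng_induced; first exact/measurable_EFinP.
by move=> x; rewrite lee_fin.
Qed.

HB.instance Definition _ := isMeasure.Build _ _ _ nu nu0 nu_ge0 nu_sigma_additive.

HB.instance Definition _ := Measure_isProbability.Build _ _ _ nu p1.

Lemma density_exists : exists nu : probability X R,
  forall A, measurable A -> nu A = \int[mu]_(x in A) (p x)%:E.
Proof. by exists nu. Qed.

End density.

(** * Integrals and divergence expressed through a density *)

Section density_theory.
Local Open Scope charge_scope.
Context d (X : measurableType d) (R : realType).
Variables (mu nu : probability X R) (p : X -> R).
Hypothesis mp : measurable_fun [set: X] p.
Hypothesis p0 : forall x, (0 <= p x)%R.
Hypothesis nuE : forall A, measurable A -> nu A = \int[mu]_(x in A) (p x)%:E.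

Lemma density_dominates : nu `<< mu.
Proof.
apply/null_content_dominatesP => A mA muA; rewrite nuE//.
apply: null_set_integral => //; apply/measurable_EFinP; exact: measurable_funTS.
Qed.

Lemma integral_density1 : \int[mu]_x (p x)%:E = 1.
Proof. by rewrite -nuE// probability_setT. Qed.

Lemma integrable_density1 : mu.-integrable [set: X] (EFin \o p).
Proof.
apply/integrableP; split; first exact/measurable_EFinP.
under eq_integral do rewrite /= ger0_norm//.
by rewrite integral_density1 ltry.
Qed.

Lemma density_Radon_Nikodym :
  ae_eq mu [set: X] (EFin \o p) ('d (charge_of_finite_measure nu) '/d mu).
Proof.
apply: integral_ae_eq => //; first exact: integrable_density1.
- apply: measurable_int; apply: Radon_Nikodym_integrable; exact: density_dominates.
- move=> A _ mA; rewrite -Radon_Nikodym_integral//; last exact: density_dominates.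
  by rewrite -nuE.
Qed.

(** Change of variables for nonnegative functions goes through the sigma-finite derivative, which
    agrees almost everywhere with the charge derivative and hence with [p]. *)
Lemma ge0_integral_density (f : X -> \bar R) : (forall x, 0 <= f x) ->
  measurable_fun [set: X] f ->
  \int[nu]_x f x = \int[mu]_x (f x * (p x)%:E).
Proof.
move=> f0 mf; have dom := density_dominates.
rewrite -(Radon_Nikodym_SigmaFinite.change_of_variables dom)//.
apply: ae_eq_integral => //.
- apply: emeasurable_funM => //.
  exact: measurable_int (Radon_Nikodym_SigmaFinite.f_integrable _).
- by apply: emeasurable_funM => //; exact/measurable_EFinP.
- apply: ae_eqe_mul2l.
  apply: (ae_eq_trans (ae_eq_Radon_Nikodym_SigmaFinite dom measurableT)).
  exact/ae_eq_sym/density_Radon_Nikodym.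
Qed.

Variable phi : X -> R.
Hypothesis mphi : measurable_fun [set: X] phi.

Lemma integral_abs_density :
  \int[nu]_x `|(phi x)%:E| = \int[mu]_x `|(phi x * p x)%:E|.
Proof.
rewrite ge0_integral_density//; last first.
  by apply: measurableT_comp => //; exact/measurable_EFinP.
by apply: eq_integral => x _; rewrite /= normrM (ger0_norm (p0 x)).
Qed.

Lemma integral_density :
  \int[nu]_x `|(phi x)%:E| < +oo ->
  \int[nu]_x (phi x)%:E = \int[mu]_x (phi x * p x)%:E.
Proof.
move=> phioo; have dom := density_dominates.
have iphi : nu.-integrable [set: X] (fun x => (phi x)%:E).
  by apply/integrableP; split => //; exact/measurable_EFinP.
rewrite -(Radon_Nikodym_change_of_variables dom)//.
apply: ae_eq_integral => //.
- apply: emeasurable_funM; first exact/measurable_EFinP.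
  by apply: measurable_int; exact: Radon_Nikodym_integrable.
- by apply/measurable_EFinP; exact: measurable_funM.
- under [X in ae_eq _ _ _ X]eq_fun do rewrite EFinM.
  by apply: ae_eqe_mul2l; exact/ae_eq_sym/density_Radon_Nikodym.
Qed.

Lemma safe_kl_density (rho : R) : (0 < rho)%R ->
  safe_kl rho nu mu = \int[mu]_x safe_kl_fun rho (p x).
Proof.
move=> r0; have dom := density_dominates.
rewrite /safe_kl asboolT//; apply: ge0_ae_eq_integral => //.
- apply: (measurableT_comp (measurable_safe_kl_fun rho)).
  apply: (measurableT_comp (@fine_measurable R setT measurableT)).
  by apply: measurable_int; exact: Radon_Nikodym_integrable.
- exact: (measurableT_comp (measurable_safe_kl_fun rho)).
- by move=> x _; exact: safe_kl_fun_ge0.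
- by move=> x _; exact: safe_kl_fun_ge0.
- have := density_Radon_Nikodym.
  by apply: filterS => x /= h hx; rewrite -h.
Qed.

End density_theory.

(** Supplies a version of the derivative that is real-valued and nonnegative at every point, so that
    pointwise inequalities apply without exceptional sets. *)
Lemma dominated_density d (X : measurableType d) (R : realType)
    (mu nu : probability X R) : nu `<< mu ->
  exists p : X -> R, [/\ measurable_fun [set: X] p, forall x, (0 <= p x)%R &
    forall A, measurable A -> nu A = \int[mu]_(x in A) (p x)%:E].
Proof.
move=> dom; pose f := Radon_Nikodym_SigmaFinite.f nu mu.
have fE x : (fine (f x))%:E = f x.
  by rewrite fineK//; exact: Radon_Nikodym_SigmaFinite.f_fin_num.
exists (fine \o f); split.
- apply: (measurableT_comp (@fine_measurable R setT measurableT)).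
  exact: measurable_int (Radon_Nikodym_SigmaFinite.f_integrable dom).
- by move=> x /=; rewrite fine_ge0// Radon_Nikodym_SigmaFinite.f_ge0.
- move=> A mA; rewrite (Radon_Nikodym_SigmaFinite.f_integral dom)//.
  by apply: eq_integral => x _; rewrite /= fE.
Qed.

(** * Lower bounds certified by a density *)

Section lower_bound.
Context d (X : measurableType d) (R : realType).
Variables (mu : probability X R) (phi p : X -> R).
Hypothesis mphi : measurable_fun [set: X] phi.
Hypothesis mp : measurable_fun [set: X] p.
Hypothesis p0 : forall x, (0 <= p x)%R.
Hypothesis p1 : \int[mu]_x (p x)%:E = 1.
Hypothesis phip : mu.-integrable [set: X] (fun x => (phi x * p x)%:E).

(** Integrating the certificate against [mu] bounds the divergence of the measure with density [p]
    by its integral of [phi] minus [a + b]; that measure is admissible in the supremum. *)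
Lemma safe_log_int_exp_ge (rho a b : R) : (0 < rho)%R ->
  (forall x, safe_kl_fun rho (p x) <= (phi x * p x - a * p x - b)%:E) ->
  (a + b)%:E <= safe_log_int_exp rho phi mu.
Proof.
move=> r0 H.
have [nu nuE] := density_exists mp p0 p1.
have ip := integrable_density1 mp p0 nuE.
have phioo : \int[nu]_x `|(phi x)%:E| < +oo.
  by rewrite (integral_abs_density mp p0 nuE mphi); case/integrableP : phip.
have E := integral_density mp p0 nuE mphi phioo.
have D := safe_kl_density mp p0 nuE r0.
have ib : mu.-integrable [set: X] (fun=> b%:E).
  exact: finite_measure_integrable_cst.
have iap : mu.-integrable [set: X] (fun x => (a * p x)%:E).
  by under eq_fun do rewrite EFinM; exact: integrableZl.
have iB1 : mu.-integrable [set: X] (fun x => (phi x * p x)%:E - (a * p x)%:E).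
  exact: integrableB.
have iB : mu.-integrable [set: X] (fun x => (phi x * p x)%:E - (a * p x)%:E - b%:E).
  exact: integrableB.
have I : \int[mu]_x ((phi x * p x)%:E - (a * p x)%:E - b%:E) =
    \int[mu]_x (phi x * p x)%:E - a%:E - b%:E.
  rewrite (integralB measurableT iB1 ib) (integralB measurableT phip iap).
  under [X in _ - X - _]eq_integral do rewrite EFinM.
  rewrite integralZl//= p1 mule1 integral_cst//.
  by rewrite [X in _ * X](probability_setT mu) mule1.
have Dle : safe_kl rho nu mu <= \int[mu]_x (phi x * p x)%:E - a%:E - b%:E.
  rewrite D -I; apply: ge0_le_integral => //.
  - by move=> x _; exact: safe_kl_fun_ge0.
  - exact: (measurableT_comp (measurable_safe_kl_fun rho)).
  - exact: measurable_int iB.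
(* Nonnegativity and the finite upper bound make the divergence a real number, so the final
   comparison is real arithmetic. *)
have Dge : 0 <= safe_kl rho nu mu.
  by rewrite D; apply: integral_ge0 => x _; exact: safe_kl_fun_ge0.
apply: le_ereal_sup_tmp; exists (\int[nu]_x (phi x)%:E - safe_kl rho nu mu).
  by exists nu.
have If : \int[mu]_x (phi x * p x)%:E \is a fin_num by exact: integrable_fin_num.
rewrite E; move: Dle Dge; rewrite -(fineK If).
by case: (safe_kl rho nu mu) => [k| |]//; rewrite !lee_fin; lra.
Qed.

End lower_bound.

Lemma le_safe_kl d (X : measurableType d) (R : realType) (rho rho' : R)
    (nu mu : probability X R) : (0 < rho)%R -> (rho <= rho')%R ->
  safe_kl rho nu mu <= safe_kl rho' nu mu.
Proof.
move=> r0 rr'; have r'0 := lt_le_trans r0 rr'.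
have [dom|ndom] := pselect (nu `<< mu); last by rewrite /safe_kl asboolF// leey.
have [p [mp p0 nuE]] := dominated_density dom.
rewrite !(safe_kl_density mp p0 nuE)//; apply: ge0_le_integral => //.
- by move=> x _; exact: safe_kl_fun_ge0.
- exact: (measurableT_comp (measurable_safe_kl_fun rho)).
- exact: (measurableT_comp (measurable_safe_kl_fun rho')).
- by move=> x _; exact: le_safe_kl_fun.
Qed.

(** * Comparison with F from above, and truncated Gibbs densities *)

Section exponential.
Context d (X : measurableType d) (R : realType).
Variables (mu : probability X R) (phi : X -> R).
Hypothesis mphi : measurable_fun [set: X] phi.

Let mexp : measurable_fun [set: X] (fun x => (expR (phi x))%:E).
Proof. by apply/measurable_EFinP; exact: (measurableT_comp (@measurable_expR R)). Qed.

(** A zero integral would make the positive function e^phi vanish almost everywhere, hence make the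
    whole space null. *)
Lemma integral_expR_gt0 : 0 < \int[mu]_x (expR (phi x))%:E.
Proof.
rewrite lt_def integral_ge0 ?andbT => [|x _]; last by rewrite lee_fin expR_ge0.
apply/eqP => I0.
have : \int[mu]_x `|(expR (phi x))%:E| = 0.
  by under eq_integral do rewrite gee0_abs ?lee_fin ?expR_ge0//.
move/ae_eq_integral_abs => /(_ measurableT mexp) [N [mN N0 sub]].
have NT : N = [set: X].
  apply/seteqP; split => // x _; apply: sub => /= /(_ I) [] /eqP.
  by rewrite expR_eq0.
have := probability_setT mu; rewrite -NT N0 => /eqP.
by rewrite eq_sym onee_eq0.
Qed.

Lemma log_int_expE (z : R) : \int[mu]_x (expR (phi x))%:E = z%:E ->
  (0 < z)%R /\ log_int_exp phi mu = (ln z)%:E.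
Proof.
move=> zE; have z0 : (0 < z)%R by rewrite -lte_fin -zE integral_expR_gt0.
by rewrite /log_int_exp zE lne_EFin.
Qed.

(** Young's inequality with [c = e^phi / z] is integrated against [mu]; the terms [1] and [c] both
    have integral [1] and cancel. Measures that are not dominated or have infinite divergence
    contribute [-oo]. *)
Lemma safe_log_int_exp_le (rho : R) : (0 < rho)%R ->
  safe_log_int_exp rho phi mu <= log_int_exp phi mu.
Proof.
move=> r0.
have Zge0 := ltW integral_expR_gt0.
case ZE : (\int[mu]_x (expR (phi x))%:E) Zge0 => [z| |]// _; last first.
  by rewrite [leRHS]/log_int_exp ZE leey.
have [z0 ->] := log_int_expE ZE.
apply: ge_ereal_sup => _ [nu phioo <-].
have [dom|ndom] := pselect (nu `<< mu); last first.
  by rewrite /safe_kl asboolF// addeNy leNye.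
have [p [mp p0 nuE]] := dominated_density dom.
rewrite (integral_density mp p0 nuE mphi phioo) (safe_kl_density mp p0 nuE r0).
have f0 : 0 <= \int[mu]_x safe_kl_fun rho (p x).
  by apply: integral_ge0 => x _; exact: safe_kl_fun_ge0.
have mf : measurable_fun [set: X] (fun x => safe_kl_fun rho (p x)).
  exact: (measurableT_comp (measurable_safe_kl_fun rho)).
have [foo|] := ltP (\int[mu]_x safe_kl_fun rho (p x)) +oo; last first.
  by rewrite leye_eq => /eqP ->; rewrite addeNy leNye.
have ikl : mu.-integrable [set: X] (fun x => safe_kl_fun rho (p x)).
  apply/integrableP; split => //.
  by under eq_integral do rewrite gee0_abs ?safe_kl_fun_ge0//.
have ip : mu.-integrable [set: X] (fun x => (p x)%:E) := integrable_density1 mp p0 nuE.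
have phip : mu.-integrable [set: X] (fun x => (phi x * p x)%:E).
  apply/integrableP; split; first by apply/measurable_EFinP; exact: measurable_funM.
  by rewrite -(integral_abs_density mp p0 nuE mphi).
have ilp : mu.-integrable [set: X] (fun x => (ln z * p x)%:E).
  by under eq_fun do rewrite EFinM; exact: integrableZl.
have ie : mu.-integrable [set: X] (fun x => (expR (phi x))%:E).
  apply/integrableP; split => //.
  by under eq_integral do rewrite gee0_abs ?lee_fin ?expR_ge0//; rewrite ZE ltry.
have iez : mu.-integrable [set: X] (fun x => (z^-1 * expR (phi x))%:E).
  by under eq_fun do rewrite EFinM; exact: integrableZl.
have i1 : mu.-integrable [set: X] (fun=> 1%:E).
  exact: finite_measure_integrable_cst.
have i2 : mu.-integrable [set: X] (fun x => (phi x * p x)%:E - (ln z * p x)%:E).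
  exact: integrableB.
have i3 : mu.-integrable [set: X] (fun x => 1%:E - (z^-1 * expR (phi x))%:E).
  exact: integrableB.
have : \int[mu]_x (((phi x * p x)%:E - (ln z * p x)%:E) +
    (1%:E - (z^-1 * expR (phi x))%:E)) <= \int[mu]_x safe_kl_fun rho (p x).
  apply: le_integral => //; first exact: integrableD.
  move=> x _.
  have c0 : (0 < expR (phi x) / z)%R by rewrite divr_gt0 ?expR_gt0.
  apply: le_trans (safe_kl_fun_ge (p x) r0 c0).
  rewrite ln_div ?posrE ?expR_gt0// expRK lee_fin; lra.
rewrite (integralD measurableT i2 i3) (integralB measurableT phip ilp).
rewrite (integralB measurableT i1 iez).
have -> : \int[mu]_x (z^-1 * expR (phi x))%:E = 1%:E.
  under eq_integral do rewrite EFinM.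
  by rewrite integralZl// ZE -EFinM mulVf// gt_eqF.
have -> : \int[mu]_x (ln z * p x)%:E = (ln z)%:E.
  under eq_integral do rewrite EFinM.
  by rewrite integralZl// (integral_density1 nuE) mule1.
rewrite integral_cst// [X in _ * X](probability_setT mu) mule1.
have If : \int[mu]_x (phi x * p x)%:E \is a fin_num by exact: integrable_fin_num.
rewrite -(fineK If); move: foo f0.
by case: (\int[mu]_x safe_kl_fun rho (p x)) => [k| |]//; rewrite !lee_fin; lra.
Qed.

(** The Gibbs density restricted to [A] is at most [expR M / z], which turns the error
    [rho * p ^+ 2] into a multiple of [p]. Both (ii) and (iv) use it. *)
Lemma safe_log_int_exp_ge_trunc (A : set X) (M z rho : R) : measurable A ->
  (forall x, A x -> (phi x <= M)%R) ->
  \int[mu]_(x in A) (expR (phi x))%:E = z%:E -> (0 < z)%R ->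
  (0 < rho)%R -> (rho * (expR M / z) <= 1)%R ->
  (ln z - rho * (expR M / z))%:E <= safe_log_int_exp rho phi mu.
Proof.
move=> mA phiM zE z0 r0 rM.
pose p x : R := (expR (phi x) * \1_A x / z)%R.
have mp : measurable_fun [set: X] p.
  apply: measurable_funM => //; apply: measurable_funM => //.
  exact: (measurableT_comp (@measurable_expR R)).
have p0 x : (0 <= p x)%R by rewrite /p divr_ge0 ?mulr_ge0 ?expR_ge0// ltW.
have pC x : (p x <= expR M / z)%R.
  rewrite /p ler_pM2r ?invr_gt0// indicE; case: (boolP (x \in A)) => xA.
    by rewrite mulr1 ler_expR phiM// -inE.
  by rewrite mulr0 expR_ge0.
have p1 : \int[mu]_x (p x)%:E = 1.
  have h : \int[mu]_x (expR (phi x) * \1_A x)%:E = z%:E.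
    rewrite -zE [RHS]integral_mkcond; apply: eq_integral => x _.
    rewrite patchE indicE; case: (x \in A); by rewrite ?mulr1 ?mulr0.
  have mh : measurable_fun [set: X] (fun x => (expR (phi x) * \1_A x)%:E).
    apply/measurable_EFinP; apply: measurable_funM => //.
    exact: (measurableT_comp (@measurable_expR R)).
  under eq_integral do rewrite /p mulrC EFinM.
  transitivity ((z^-1)%:E * z%:E); last by rewrite -EFinM mulVf ?gt_eqF.
  rewrite -h; apply: ge0_integralZl => //; last by rewrite lee_fin invr_ge0 ltW.
have phip : mu.-integrable [set: X] (fun x => (phi x * p x)%:E).
  (* On [A], [|phi| * e^phi] is at most [|M| * e^M] where [phi >= 0], and at most [1] where
     [phi < 0]. *)
  pose K := ((1 + `|M| * expR M) / z)%R.
  apply: (@le_integrable _ _ _ mu _ measurableT _ (EFin \o cst K)).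
  - by apply/measurable_EFinP; exact: measurable_funM.
  - move=> x _; rewrite lee_fin [leRHS]ger0_norm; last first.
      by rewrite divr_ge0 ?addr_ge0 ?mulr_ge0 ?expR_ge0// ltW.
    rewrite normrM (ger0_norm (p0 x)) /p /K mulrA ler_pM2r ?invr_gt0//.
    rewrite indicE; case: (boolP (x \in A)) => xA; last first.
      by rewrite !mulr0 addr_ge0 ?mulr_ge0 ?expR_ge0.
    rewrite mulr1; have := phiM x; rewrite -inE => /(_ xA) xM.
    have [phi0|phi0] := leP 0%R (phi x).
      rewrite (le_trans (y := (`|M| * expR M)%R)) ?lerDr//.
      rewrite ler_pM ?expR_ge0 ?ler_expR// ger0_norm//.
      exact: le_trans xM (ler_norm _).
    rewrite (le_trans (y := 1%R)) ?lerDl ?mulr_ge0 ?expR_ge0//.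
    rewrite ltr0_norm// -ler_pdivlMr ?expR_gt0// div1r -expRN.
    by have := expR_ge1Dx (- phi x)%R; lra.
  - exact: finite_measure_integrable_cst.
(* These [a] and [b] are the coefficients left by [t * ln t + 1 - t + rho * t ^+ 2] at [t = p x],
   once [ln (p x) = phi x - ln z] on [A] is inserted. *)
have := @safe_log_int_exp_ge _ _ _ mu phi p mphi mp p0 p1 phip rho
  (ln z + 1 - rho * (expR M / z))%R (-1)%R r0.
rewrite (_ : (_ + 1 - _ + -1 = ln z - rho * (expR M / z))%R); last by ring.
apply => x.
have rp : (rho * p x <= 1)%R by rewrite (le_trans _ rM)// ler_pM2l.
apply: (le_trans (safe_kl_fun_le r0 (p0 x) rp)).
rewrite lee_fin.
have -> : (p x * ln (p x) = p x * (phi x - ln z))%R.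
  rewrite /p indicE; case: (x \in A); last by rewrite mulr0 !mul0r.
  by rewrite mulr1 ln_div ?posrE ?expR_gt0// expRK.
have : (rho * p x ^+ 2 <= rho * (expR M / z) * p x)%R.
  by rewrite expr2 -mulrA ler_pM2l// ler_wpM2r.
lra.
Qed.

End exponential.

(** * The second-moment lower bound and the limit as rho tends to 0 *)

Section lower_bounds.
Context d (X : measurableType d) (R : realType).
Variables (mu : probability X R) (phi : X -> R).
Hypothesis mphi : measurable_fun [set: X] phi.

Lemma safe_log_int_exp_ge_sqr (z z2 rho : R) : (0 < z)%R -> (0 < rho)%R ->
  \int[mu]_x (expR (phi x))%:E = z%:E ->
  \int[mu]_x (expR (phi x) ^+ 2)%:E = z2%:E -> (rho * (z2 / z ^+ 2) < 1)%R ->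
  (ln z + rho / 2 + ln (1 - rho * (z2 / z ^+ 2)))%:E <= safe_log_int_exp rho phi mu.
Proof.
move=> z0 r0 zE z2E rk.
have mexp : measurable_fun [set: X] (fun x => expR (phi x)).
  exact: (measurableT_comp (@measurable_expR R)).
have mexp2 : measurable_fun [set: X] (fun x => expR (phi x) ^+ 2)%R.
  exact: measurable_funX.
have ie : mu.-integrable [set: X] (fun x => (expR (phi x))%:E).
  apply/integrableP; split; first exact/measurable_EFinP.
  by under eq_integral do rewrite gee0_abs ?lee_fin ?expR_ge0//; rewrite zE ltry.
have ie2 : mu.-integrable [set: X] (fun x => (expR (phi x) ^+ 2)%:E).
  apply/integrableP; split; first exact/measurable_EFinP.
  by under eq_integral do rewrite gee0_abs ?lee_fin ?sqr_ge0//; rewrite z2E ltry.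
pose q x : R := (z^-1 * expR (phi x))%R.
have mq : measurable_fun [set: X] q by exact: measurable_funM.
have q0 x : (0 < q x)%R by rewrite mulr_gt0 ?invr_gt0 ?expR_gt0.
have iq : mu.-integrable [set: X] (EFin \o q).
  rewrite (_ : _ \o _ = fun x => (z^-1)%:E * (expR (phi x))%:E); first exact: integrableZl.
  by apply/funext => x /=; rewrite EFinM.
have q1 : (\int[mu]_x q x = 1)%R.
  by rewrite RintegralZl// /Rintegral zE /= mulVf// gt_eqF.
have q2E : (fun x => q x ^+ 2)%R = (fun x => z^-2 * expR (phi x) ^+ 2)%R.
  by apply/funext => x; rewrite /q exprMn exprVn.
have iq2 : mu.-integrable [set: X] (EFin \o (fun x => q x ^+ 2)%R).
  rewrite q2E (_ : _ \o _ = fun x => (z^-2)%:E * (expR (phi x) ^+ 2)%:E).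
    exact: integrableZl.
  by apply/funext => x /=; rewrite EFinM.
have q2 : (\int[mu]_x (q x ^+ 2) = z2 / z ^+ 2)%R.
  by rewrite q2E RintegralZl// /Rintegral z2E /= mulrC.
have [y /andP[y1 yc] [p1 mp]] := tilted_density_exists mq q0 r0 iq q1 iq2 q2 rk.
have y0 := lt_le_trans ltr01 y1.
have c0 : (0 < 1 - rho * (z2 / z ^+ 2))%R by rewrite subr_gt0.
set p := (fun x => _ : R) in mp.
have yq0 x : (0 < y * q x)%R by rewrite mulr_gt0.
have w1 x : (1 <= 1 + rho * (y * q x))%R by rewrite lerDl mulr_ge0// ltW.
have w0 x := lt_le_trans ltr01 (w1 x).
have p0 x : (0 <= p x)%R by rewrite /p divr_ge0// ltW.
have ple x : (p x <= y * q x)%R by rewrite /p ler_pdivrMr// ler_peMr// ltW.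
have phip : mu.-integrable [set: X] (fun x => (phi x * p x)%:E).
  (* The majorant comes from [|phi| * e^phi <= 1 + e^(2 phi)], using [phi <= e^phi] where
     [phi >= 0]. *)
  have iK : mu.-integrable [set: X] (fun x => (y / z)%:E * (1%:E + (expR (phi x) ^+ 2)%:E)).
    apply: integrableZl => //; apply: integrableD => //.
    exact: finite_measure_integrable_cst.
  apply: (le_integrable measurableT _ _ iK).
    by apply/measurable_EFinP; exact: measurable_funM.
  move=> x _; rewrite -EFinD -EFinM lee_fin [leRHS]ger0_norm; last first.
    by rewrite mulr_ge0 ?divr_ge0 ?addr_ge0 ?sqr_ge0// ltW.
  rewrite normrM (ger0_norm (p0 x)).
  apply: (le_trans (ler_wpM2l (normr_ge0 _) (ple x))).
  have -> : (`|phi x| * (y * q x) = y / z * (`|phi x| * expR (phi x)))%R by rewrite /q; ring.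
  rewrite ler_wpM2l ?divr_ge0 ?(ltW y0) ?(ltW z0)//.
  have [phi0|phi0] := leP 0%R (phi x).
    rewrite (le_trans (y := (expR (phi x) ^+ 2)%R)) ?lerDr//.
    rewrite expr2 ler_wpM2r ?expR_ge0// ger0_norm//.
    by have := expR_ge1Dx (phi x); lra.
  rewrite (le_trans (y := 1%R)) ?lerDl ?sqr_ge0//.
  rewrite ltr0_norm// -ler_pdivlMr ?expR_gt0// div1r -expRN.
  by have := expR_ge1Dx (- phi x)%R; lra.
(* The gain [rho / 2] arises by linearizing the quadratic term at the mean of [p]:
   [p ^+ 2 >= 2 * p - 1] puts [rho] into [a] and [- rho / 2] into [b]. *)
have := @safe_log_int_exp_ge _ _ _ mu phi p mphi mp p0 p1 phip rho
  (ln z - ln y + 1 + rho)%R (- 1 - rho / 2)%R r0.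
move=> H; apply: le_trans (H _); last first.
  move=> x; apply: le_trans (safe_kl_fun_opt r0 (mulr_gt0 y0 (q0 x))) _.
  rewrite -/(p x) lee_fin.
  have -> : (ln (y * q x) = ln y + (phi x - ln z))%R.
    by rewrite !lnM ?posrE ?invr_gt0 ?mulr_gt0 ?expR_gt0 ?invr_gt0// lnV ?posrE// expRK; ring.
  have : (0 <= rho * (p x - 1) ^+ 2)%R by rewrite mulr_ge0 ?sqr_ge0 ?ltW.
  lra.
rewrite lee_fin.
have : (ln y <= - ln (1 - rho * (z2 / z ^+ 2)))%R.
  by rewrite -lnV ?posrE// ler_ln ?posrE ?invr_gt0.
lra.
Qed.

(* The densities [e^phi 1_{phi <= n} / z_n] are bounded, and [z_n] increases
   to the integral of [e^phi]. *)
Lemma safe_log_int_exp_near_ge (a : R) : a%:E < log_int_exp phi mu ->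
  \forall rho \near (0%R : R)^'+, a%:E <= safe_log_int_exp rho phi mu.
Proof.
move=> aF.
pose A n := [set x | (phi x <= n%:R)%R].
have mA n : measurable (A n).
  rewrite -[A n]setTI; have := @measurable_fun_ler _ _ _ setT phi (cst n%:R) mphi.
  move=> /(_ (measurable_cst _)) /(_ measurableT [set true]) => /(_ I).
  by congr (measurable (_ `&` _)); apply/seteqP; split => x /=; rewrite /A/=.
have mexp : measurable_fun [set: X] (fun x => expR (phi x)).
  exact: (measurableT_comp (@measurable_expR R)).
pose g n x : \bar R := (expR (phi x) * \1_(A n) x)%:E.
have gE n : \int[mu]_(x in A n) (expR (phi x))%:E = \int[mu]_x g n x.
  rewrite integral_mkcond; apply: eq_integral => x _.
  by rewrite /g patchE indicE; case: (x \in A n); rewrite ?mulr1 ?mulr0.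
have cvg : \int[mu]_x g n x @[n --> \oo] --> \int[mu]_x (expR (phi x))%:E.
  have -> : \int[mu]_x (expR (phi x))%:E = \int[mu]_x (limn (g ^~ x)).
    apply: eq_integral => x _; apply/esym/cvg_lim => //.
    (* At a fixed [x] the truncation is inactive as soon as [n] exceeds [|phi x|]. *)
    apply: cvg_near_cst; exists (Num.bound `|phi x|) => // n /= nb.
    rewrite /g indicE mem_set ?mulr1//= /A/=.
    rewrite (le_trans (ler_norm _))// ltW// (lt_le_trans (archi_boundP _))//.
    by rewrite ler_nat.
  apply: cvg_monotone_convergence => //.
  - move=> n; apply/measurable_EFinP; exact: measurable_funM.
  - by move=> n x _; rewrite lee_fin mulr_ge0 ?expR_ge0.
  - move=> x _ n m nm; rewrite lee_fin ler_wpM2l ?expR_ge0// !indicE ler_nat.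
    case: (boolP (x \in A n)) => // xA; rewrite mem_set//=.
    by move: xA; rewrite inE /A/= => /le_trans; apply; rewrite ler_nat.
have aZ : (expR a)%:E < \int[mu]_x (expR (phi x))%:E.
  rewrite -lte_lne ?in_itv/= ?leey ?andbT ?lee_fin ?expR_ge0//; last first.
    exact/ltW/integral_expR_gt0.
  by rewrite leNgt expR_gt0/= expRK.
have [n an] : exists n, (expR a)%:E < \int[mu]_x g n x.
  have [N _ H] : \forall n \near \oo, (expR a)%:E < \int[mu]_x g n x.
    exact: (cvg _ (open_ereal_gt' aZ)).
  by exists N; apply: H => /=.
have gfin : \int[mu]_x g n x <= (expR n%:R)%:E.
  rewrite -[leRHS]mule1 -(probability_setT mu) -integral_cst//.
  apply: ge0_le_integral => //.
  - by move=> x _; rewrite lee_fin mulr_ge0 ?expR_ge0.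
  - by apply/measurable_EFinP; exact: measurable_funM.
  - move=> x _; rewrite lee_fin indicE; case: (boolP (x \in A n)).
      by rewrite inE mulr1 ler_expR.
    by rewrite mulr0 expR_ge0.
case zE : (\int[mu]_x g n x) gfin an => [z| |]// _; rewrite lte_fin => az.
have z0 : (0 < z)%R by rewrite (lt_trans (expR_gt0 a)).
have alnz : (a < ln z)%R by rewrite -ltr_expR lnK.
pose C := (expR n%:R / z)%R.
have C0 : (0 < C)%R by rewrite divr_gt0 ?expR_gt0.
(* [rho * C <= 1] makes the truncated bound available, and [rho * C <= ln z - a] keeps it above
   [a]. *)
near=> rho.
have rho0 : (0 < rho)%R by near: rho; exact: nbhs_right_gt.
have rC : (rho <= C^-1)%R by near: rho; apply: nbhs_right_le; rewrite invr_gt0.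
have ra : (rho <= (ln z - a) / C)%R.
  by near: rho; apply: nbhs_right_le; rewrite divr_gt0// subr_gt0.
apply: le_trans (@safe_log_int_exp_ge_trunc _ _ _ mu phi mphi (A n) n%:R z rho
  (mA n) _ _ z0 rho0 _) => //.
- by rewrite lee_fin -/C; move: ra; rewrite ler_pdivlMr//; lra.
- by rewrite gE zE.
- by rewrite -/C -ler_pdivlMr// div1r.
Unshelve. all: by end_near. Qed.

(** A squeeze: F bounds F_rho from above for every positive [rho], and each real [a < F] is
    eventually a lower bound. Finite and infinite F are handled separately. *)
Lemma cvg_safe_log_int_exp :
  safe_log_int_exp rho phi mu @[rho --> (0%R : R)^'+] --> log_int_exp phi mu.
Proof.
have ub : \forall rho \near (0%R : R)^'+, safe_log_int_exp rho phi mu <= log_int_exp phi mu.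
  by near=> rho; apply: safe_log_int_exp_le => //; near: rho; exact: nbhs_right_gt.
have lb := safe_log_int_exp_near_ge.
case FE : (log_int_exp phi mu) ub lb => [l| |] ub lb.
- have near_fin : \forall rho \near (0%R : R)^'+, safe_log_int_exp rho phi mu \is a fin_num.
    have /lb h : (l - 1)%:E < l%:E by rewrite lte_fin ltrBlDr ltrDl.
    near=> rho; rewrite fin_numE; apply/andP; split.
      rewrite gt_eqF// (lt_le_trans (ltNyr (l - 1)))//.
      by near: rho.
    by rewrite lt_eqF// (@le_lt_trans _ _ l%:E) ?ltry//; near: rho.
  apply/fine_cvgP; split => //; apply/cvgrPdist_le => e e0.
  have /lb h : (l - e)%:E < l%:E by rewrite lte_fin ltrBlDr ltrDl.
  near=> rho => /=.
  have h1 : (l - e)%:E <= safe_log_int_exp rho phi mu by near: rho.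
  have h2 : safe_log_int_exp rho phi mu <= l%:E by near: rho.
  have h3 : safe_log_int_exp rho phi mu \is a fin_num by near: rho.
  move: h1 h2; rewrite -(fineK h3) !lee_fin /= => h1 h2.
  by rewrite ler_norml; apply/andP; split; lra.
- by apply/cvgeyPge => a; apply: lb; rewrite ltry.
- have := integral_expR_gt0 mu mphi.
  move: FE; rewrite /log_int_exp; case: (\int[mu]_x _) => [z| |]//.
  by move=> /[swap]; rewrite lte_fin => z0; rewrite lne_EFin.
Unshelve. all: by end_near. Qed.

End lower_bounds.

(** * Assembly of the four claims *)

Theorem proposition2p4 (d : measure_display) (X : measurableType d)
    (R : realType) (mu : probability X R) (phi : X -> R)
    (mphi : measurable_fun [set: X] phi) :
  [/\ (forall rho rho' : R, (0 < rho)%R -> (rho <= rho')%R -> (rho' < 1)%R ->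
         safe_log_int_exp rho' phi mu <= safe_log_int_exp rho phi mu),
      safe_log_int_exp rho phi mu @[rho --> (0%R : R)^'+]
        --> log_int_exp phi mu,
      (log_int_exp (fun x => 2 * phi x)%R mu < +oo ->
       forall rho : R, (0 < rho)%R -> rho%:E < (exp_kappa phi mu)^-1 ->
         log_int_exp phi mu + (rho / 2)%:E
           + lne (1 - rho%:E * exp_kappa phi mu)
         <= safe_log_int_exp rho phi mu)
    & (forall M : R, (forall x, (phi x <= M)%R) ->
       forall rho : R, (0 < rho)%R ->
         rho%:E < expeR (log_int_exp phi mu - M%:E) ->
         log_int_exp phi mu - rho%:E * expeR (M%:E - log_int_exp phi mu)
         <= safe_log_int_exp rho phi mu)].
Proof.
have expR2 x : (expR (2 * phi x) = expR (phi x) ^+ 2)%R by rewrite expRM_natl.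
have mexp : measurable_fun [set: X] (fun x => expR (phi x)).
  exact: (measurableT_comp (@measurable_expR R)).
split.
- move=> rho rho' r0 rr' _; apply: ge_ereal_sup => _ [nu phioo <-].
  apply: le_ereal_sup_tmp; exists (\int[nu]_x (phi x)%:E - safe_kl rho nu mu).
    by exists nu.
  by rewrite leeD2l// leeN2; exact: le_safe_kl.
- exact: cvg_safe_log_int_exp.
- move=> F2oo rho r0 rk.
  have z2E : exists z2 : R, \int[mu]_x (expR (2 * phi x))%:E = z2%:E.
    move: F2oo; rewrite /log_int_exp.
    have : 0 <= \int[mu]_x (expR (2 * phi x))%:E.
      by apply: integral_ge0 => x _; rewrite lee_fin expR_ge0.
    by case: (\int[mu]_x _) => [z2| |]// _ _; exists z2.
  have {z2E} [z2 z2E] := z2E.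
  have z2E' : \int[mu]_x (expR (phi x) ^+ 2)%:E = z2%:E.
    by rewrite -z2E; apply: eq_integral => x _; rewrite expR2.
  (* Finiteness of the first exponential moment follows from that of the second through
     [e^phi <= 1 + e^(2 phi)]. *)
  have [z zE] : exists z : R, \int[mu]_x (expR (phi x))%:E = z%:E.
    have mexp2 : measurable_fun [set: X] (fun x => (expR (phi x) ^+ 2)%:E).
      by apply/measurable_EFinP; exact: measurable_funX.
    have I : \int[mu]_x (1%:E + (expR (phi x) ^+ 2)%:E) = (1 + z2)%:E.
      rewrite ge0_integralD//.
      by rewrite integral_cst// [X in _ * X](probability_setT mu) mule1 z2E'.
    have : \int[mu]_x (expR (phi x))%:E <= (1 + z2)%:E.
      rewrite -I; apply: ge0_le_integral => //.
      - exact/measurable_EFinP.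
      - exact: emeasurable_funD.
      - move=> x _; rewrite -EFinD lee_fin.
        by have := sqr_ge0 (expR (phi x) - 1)%R; have := expR_ge0 (phi x); lra.
    have := integral_expR_gt0 mu mphi.
    by case: (\int[mu]_x _) => [z| |]// _ _; exists z.
  have [z0 FE] := log_int_expE mphi zE.
  have mphi2 : measurable_fun [set: X] (fun x => 2 * phi x)%R by exact: measurable_funM.
  have [z20 F2E] := log_int_expE mphi2 z2E.
  have kE : exp_kappa phi mu = (z2 / z ^+ 2)%:E.
    rewrite /exp_kappa FE F2E -EFinM -EFinB /= expRB lnK ?posrE//.
    by rewrite expRM_natl lnK ?posrE.
  have k0 : (0 < z2 / z ^+ 2)%R by rewrite divr_gt0 ?exprn_gt0.
  move: rk; rewrite kE inver gt_eqF// lte_fin -div1r ltr_pdivlMr// => rk.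
  rewrite FE -EFinM -EFinB lne_EFin ?subr_gt0//.
  rewrite -!EFinD; exact: safe_log_int_exp_ge_sqr.
- move=> M phiM rho r0.
  have [z zE] : exists z : R, \int[mu]_x (expR (phi x))%:E = z%:E.
    have : \int[mu]_x (expR (phi x))%:E <= (expR M)%:E.
      rewrite -[leRHS]mule1 -(probability_setT mu) -integral_cst//.
      apply: ge0_le_integral => //.
      + exact/measurable_EFinP.
      + by move=> x _; rewrite lee_fin ler_expR.
    have := integral_expR_gt0 mu mphi.
    by case: (\int[mu]_x _) => [z| |]// _ _; exists z.
  have [z0 FE] := log_int_expE mphi zE.
  rewrite FE -!EFinB /= !expRB lnK ?posrE// lte_fin => rM.
  (* With [phi] bounded everywhere, no truncation is made: [A] is the whole space. *)
  apply: (safe_log_int_exp_ge_trunc mphi measurableT) => //.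
  by rewrite -ler_pdivlMr ?divr_gt0 ?expR_gt0// div1r invf_div ltW.
Qed.
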